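(* Consider the single stage pricing game with linear loyalty described in the context, with parameters $c_A\ge c_B\ge 0$, $l_\alpha,l_\beta>0$, $s_\alpha,s_\beta\ge 0$, $\theta\in(0,1)$, and $F$ the distribution function of the uniform distribution on $[0,1]$. Suppose (Region III) $$\max(l_\beta-s_\beta,\;s_\alpha+2l_\alpha)\le c_A-c_B .$$ Then the game has a unique pure Nash equilibrium, and its prices are $$p_A^\alpha=c_A,\quad p_A^\beta=c_A,\quad p_B^\beta=c_A+s_\beta,\quad p_B^\alpha=c_A-s_\alpha-l_\alpha .$$
   Context: Two firms $A$ and $B$ sell the same product, with unit product costs $c_A$ and $c_B$, where $c_A\ge c_B\ge 0$. Customers are partitioned into a set $\alpha$ (ex ante loyal to $A$; a fraction $\theta$ of the market; $A$'s strong and $B$'s weak sub-market) and a set $\beta$ (ex ante loyal to $B$; a fraction $1-\theta$; $B$'s strong and $A$'s weak sub-market). Both firms can tell the two sets apart. Each customer buys exactly one unit, from $A$ or from $B$. Firms move simultaneously: $A$ chooses $(p_A^\alpha,p_A^\beta)$ with $p_A^\alpha,p_A^\beta\ge c_A$, and $B$ chooses $(p_B^\beta,p_B^\alpha)$ with $p_B^\beta,p_B^\alpha\ge c_B$; the superscript is the set of customers to which the price is offered. Linear loyalty: a customer in $\alpha$ has loyalty level $l_\alpha\xi+s_\alpha$ and buys from $A$ iff $l_\alpha\xi+s_\alpha\ge p_A^\alpha-p_B^\alpha$; a customer in $\beta$ has loyalty level $l_\beta\xi+s_\beta$ and buys from $B$ iff $l_\beta\xi+s_\beta\ge p_B^\beta-p_A^\beta$;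 here $\xi$ is random with distribution function $F$. Put $\xi^\alpha=(p_A^\alpha-p_B^\alpha-s_\alpha)/l_\alpha$ and $\xi^\beta=(p_B^\beta-p_A^\beta-s_\beta)/l_\beta$. For the uniform distribution, $F(x)=0$ for $x\le 0$, $F(x)=x$ for $0\le x\le1$, $F(x)=1$ for $x\ge1$. Profits: firm $A$ gets $(p_A^\alpha-c_A)\,\theta\,(1-F(\xi^\alpha))+(p_A^\beta-c_A)(1-\theta)F(\xi^\beta)$; firm $B$ gets $(p_B^\beta-c_B)(1-\theta)(1-F(\xi^\beta))+(p_B^\alpha-c_B)\,\theta\,F(\xi^\alpha)$. A pure Nash equilibrium is a price profile $(p_A^\alpha,p_A^\beta,p_B^\beta,p_B^\alpha)$ from which neither firm can strictly increase its profit by unilaterally changing its own (feasible) prices. *)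

(* Defs.v *)
From mathcomp Require Import all_boot all_order all_algebra.
From mathcomp Require Import reals.

Set Implicit Arguments.
Unset Strict Implicit.
Unset Printing Implicit Defensive.

Import Order.TTheory GRing.Theory Num.Theory.
Local Open Scope ring_scope.

(** Customers are split into [alpha] (ex ante loyal to [A], a fraction
    [theta] of the market) and [beta] (ex ante loyal to [B], a fraction
    [1 - theta]).  A customer of the set [i] has loyalty level
    [l_i * xi + s_i], with [xi] random. *)
Record market (R : realType) := Market {
  costA : R;
  costB : R;
  l_alpha : R;
  l_beta : R;
  s_alpha : R;
  s_beta : R;
  theta : R
}.

(** The strong sub-market of [A] is [alpha] and that of [B] is [beta]; so
    [strong] is p_A^alpha for [A] and p_B^beta for [B], while [weak] is
    p_A^beta for [A] and p_B^alpha for [B]. *)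
Record prices (R : realType) := Prices { strong : R; weak : R }.

Definition feasible (R : realType) (c : R) (p : prices R) : Prop :=
  c <= strong p /\ c <= weak p.

Definition uniform_cdf (R : realType) (x : R) : R :=
  if x <= 0 then 0 else if x <= 1 then x else 1.

Section Game.
Variables (R : realType) (M : market R) (F : R -> R).
Implicit Types pA pB : prices R.

(** A customer of [alpha] buys from [B] iff [xi < xi_alpha pA pB]; a customer
    of [beta] buys from [A] iff [xi < xi_beta pA pB]. *)
Definition xi_alpha pA pB : R :=
  (strong pA - weak pB - s_alpha M) / l_alpha M.

Definition xi_beta pA pB : R :=
  (strong pB - weak pA - s_beta M) / l_beta M.

(** [F] is the distribution function of [xi]. *)
Definition profitA pA pB : R :=
  (strong pA - costA M) * theta M * (1 - F (xi_alpha pA pB))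
  + (weak pA - costA M) * (1 - theta M) * F (xi_beta pA pB).

Definition profitB pA pB : R :=
  (strong pB - costB M) * (1 - theta M) * (1 - F (xi_beta pA pB))
  + (weak pB - costB M) * theta M * F (xi_alpha pA pB).

Definition pure_nash pA pB : Prop :=
  [/\ feasible (costA M) pA,
      feasible (costB M) pB,
      forall qA, feasible (costA M) qA -> profitA qA pB <= profitA pA pB &
      forall qB, feasible (costB M) qB -> profitB pA qB <= profitB pA pB].

End Game.

(* Main.v *)
(** On each sub-market the demand of a firm facing a fixed rival price is
    [F ((u + l - p) / l)], where [u] is its limit price, the highest price that
    captures the whole sub-market.  When the margin [u - c] is at least [l],
    the limit price is the unique best response.  In Region III this applies to
    [B] on both sub-markets, whatever feasible prices [A] sets; so in
    equilibrium [A] sells nothing, and [A] could profitably undercut with any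
    price above [c_A]. *)

Require Import Defs.
From mathcomp Require Import all_boot all_order all_algebra.
From mathcomp Require Import reals.
From mathcomp Require Import ring lra.

Set Implicit Arguments.
Unset Strict Implicit.
Unset Printing Implicit Defensive.

Import Order.TTheory GRing.Theory Num.Theory.
Local Open Scope ring_scope.

Lemma uniform_cdf_ge0 (R : realType) (x : R) : 0 <= uniform_cdf x.
Proof.
by rewrite /uniform_cdf; case: (leP x 0); case: (leP x 1) => // *; lra.
Qed.

Lemma uniform_cdf_le1 (R : realType) (x : R) : uniform_cdf x <= 1.
Proof.
by rewrite /uniform_cdf; case: (leP x 0); case: (leP x 1) => // *; lra.
Qed.

Lemma uniform_cdf_gt0 (R : realType) (x : R) : 0 < x -> 0 < uniform_cdf x.
Proof.
by rewrite /uniform_cdf; case: (leP x 0); case: (leP x 1) => // *; lra.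
Qed.

Lemma uniform_cdf1 (R : realType) : uniform_cdf (1 : R) = 1.
Proof. by rewrite /uniform_cdf lexx ler10. Qed.

Lemma uniform_cdf_eq0 (R : realType) (x : R) : x <= 0 -> uniform_cdf x = 0.
Proof. by rewrite /uniform_cdf => ->. Qed.

(** The uniform law is symmetric about 1/2. This turns the demand [1 - F] of a strong sub-market
    into the same form as the demand [F] of a weak one. *)
Lemma onem_uniform_cdf (R : realType) (x : R) :
  1 - uniform_cdf x = uniform_cdf (1 - x).
Proof.
rewrite /uniform_cdf; case: (leP x 0) => ?; case: (leP x 1) => ?;
  case: (leP (1 - x) 0) => ?; case: (leP (1 - x) 1) => ?; lra.
Qed.

Definition margin_revenue (R : realType) (c l u p : R) : R :=
  (p - c) * uniform_cdf ((u + l - p) / l).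

Lemma margin_revenue_limit (R : realType) (c l u : R) :
  0 < l -> margin_revenue c l u u = u - c.
Proof.
move=> l_gt0; rewrite /margin_revenue (addrC u l) addrK divff ?gt_eqF //.
by rewrite uniform_cdf1 mulr1.
Qed.

Lemma margin_revenue_eq0 (R : realType) (c l u p : R) :
  0 < l -> u + l <= p -> margin_revenue c l u p = 0.
Proof.
move=> l_gt0 le_p; rewrite /margin_revenue uniform_cdf_eq0 ?mulr0 //.
by rewrite ler_pdivrMr // mul0r subr_le0.
Qed.

Lemma margin_revenue_gt0 (R : realType) (c l u p : R) :
  0 < l -> c < p -> p < u + l -> 0 < margin_revenue c l u p.
Proof.
move=> l_gt0 lt_cp lt_p; rewrite /margin_revenue mulr_gt0 ?subr_gt0 //.
by rewrite uniform_cdf_gt0 // divr_gt0 // subr_gt0.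
Qed.

(** Below [u] demand is already full, so a lower price only cuts the margin; from [u + l] on nothing
    is sold. In between, the revenue is a concave quadratic whose slope at [u], namely
    [1 - (u - c) / l], is at most 0. *)
Lemma margin_revenue_lt_limit (R : realType) (c l u p : R) :
  0 < l -> l <= u - c -> p != u -> margin_revenue c l u p < u - c.
Proof.
move=> l_gt0 le_l p_neq_u.
have [lt_pu | lt_up | /eqP] := ltgtP p u; last by rewrite (negPf p_neq_u).
  have F_ge0 := uniform_cdf_ge0 ((u + l - p) / l).
  have F_le1 := uniform_cdf_le1 ((u + l - p) / l).
  rewrite /margin_revenue; have [le_pc | lt_cp] := leP p c.
    apply: (@le_lt_trans _ _ 0); last lra.
    by rewrite mulr_le0_ge0 // subr_le0.
  apply: (@le_lt_trans _ _ (p - c)); last lra.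
  by rewrite ler_piMr // subr_ge0 ltW.
have [le_p | lt_p] := leP (u + l) p.
  by rewrite margin_revenue_eq0 //; lra.
set t := (p - u) / l; have tl : t * l = p - u by rewrite divfK ?gt_eqF.
have t_gt0 : 0 < t by rewrite divr_gt0 // subr_gt0.
have -> : margin_revenue c l u p = (p - c) * (1 - t).
  have -> : 1 - t = (u + l - p) / l by rewrite /t; field; rewrite gt_eqF.
  rewrite /margin_revenue /uniform_cdf leNgt divr_gt0 ?subr_gt0 //=.
  by rewrite ler_pdivrMr // ifT //; lra.
(* With [p = u + t * l], the product is [(u - c) - t * (u - c - l) - t ^ 2 * l]. *)
nra.
Qed.

Lemma margin_revenue_le_limit (R : realType) (c l u p : R) :
  0 < l -> l <= u - c -> margin_revenue c l u p <= margin_revenue c l u u.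
Proof.
move=> l_gt0 le_l; rewrite (margin_revenue_limit c u l_gt0).
have [-> | p_neq_u] := eqVneq p u; first by rewrite margin_revenue_limit.
exact/ltW/margin_revenue_lt_limit.
Qed.

Lemma best_response_eq_limit (R : realType) (c l u p : R) :
  0 < l -> l <= u - c ->
  (forall q, c <= q -> margin_revenue c l u q <= margin_revenue c l u p) ->
  p = u.
Proof.
move=> l_gt0 le_l best_p; apply/eqP/negPn/negP => p_neq_u.
have le_cu : c <= u by lra.
move: (best_p u le_cu); rewrite margin_revenue_limit // leNgt.
by rewrite margin_revenue_lt_limit.
Qed.

(** Sales vanish at [u + l], whereas any price strictly between [c] and [u + l], such as the
    midpoint, earns a positive amount. *)
Lemma best_response_unsold (R : realType) (c l u : R) :
  0 < l -> c <= u + l ->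
  (forall q, c <= q -> margin_revenue c l u q <= margin_revenue c l u (u + l)) ->
  u + l = c.
Proof.
move=> l_gt0 le_c best; apply/eqP; rewrite eq_le le_c andbT leNgt.
apply/negP => lt_c; have /best : c <= (c + (u + l)) / 2 by lra.
rewrite (margin_revenue_eq0 c l_gt0 (lexx (u + l))) leNgt.
by rewrite margin_revenue_gt0 //; lra.
Qed.

Section ProfitDecomposition.
Variables (R : realType) (M : market R).
Hypotheses (la_gt0 : 0 < l_alpha M) (lb_gt0 : 0 < l_beta M).
Hypotheses (th_gt0 : 0 < theta M) (th_lt1 : theta M < 1).
Implicit Types pA pB : prices R.

(** Every [alpha] customer has loyalty at least [s_alpha], so [A] keeps them all up to this premium
    over the rival price. *)
Definition strong_revenueA pA pB : R :=
  margin_revenue (costA M) (l_alpha M) (weak pB + s_alpha M) (strong pA).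

(** Winning all of [beta] means undercutting by the highest loyalty level, [s_beta + l_beta]. *)
Definition weak_revenueA pA pB : R :=
  margin_revenue (costA M) (l_beta M) (strong pB - s_beta M - l_beta M)
    (weak pA).

Definition strong_revenueB pA pB : R :=
  margin_revenue (costB M) (l_beta M) (weak pA + s_beta M) (strong pB).

Definition weak_revenueB pA pB : R :=
  margin_revenue (costB M) (l_alpha M) (strong pA - s_alpha M - l_alpha M)
    (weak pB).

Lemma profitAE pA pB :
  profitA M (@uniform_cdf R) pA pB =
  theta M * strong_revenueA pA pB + (1 - theta M) * weak_revenueA pA pB.
Proof.
rewrite /profitA /strong_revenueA /weak_revenueA /margin_revenue onem_uniform_cdf.
rewrite /xi_alpha /xi_beta.
have -> : 1 - (strong pA - weak pB - s_alpha M) / l_alpha M =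
    (weak pB + s_alpha M + l_alpha M - strong pA) / l_alpha M.
  by field; rewrite gt_eqF.
rewrite subrK (addrAC (strong pB)); ring.
Qed.

Lemma profitBE pA pB :
  profitB M (@uniform_cdf R) pA pB =
  (1 - theta M) * strong_revenueB pA pB + theta M * weak_revenueB pA pB.
Proof.
rewrite /profitB /strong_revenueB /weak_revenueB /margin_revenue onem_uniform_cdf.
rewrite /xi_alpha /xi_beta.
have -> : 1 - (strong pB - weak pA - s_beta M) / l_beta M =
    (weak pA + s_beta M + l_beta M - strong pB) / l_beta M.
  by field; rewrite gt_eqF.
rewrite subrK (addrAC (strong pA)); ring.
Qed.

(** Each profit is a sum, with positive weights, of two revenues that each involve only one of the
    firm's own prices. Deviating in one price at a time therefore separates the sub-markets. *)
Lemma pure_nashP pA pB :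
  pure_nash M (@uniform_cdf R) pA pB <->
  [/\ feasible (costA M) pA, feasible (costB M) pB,
      (forall qA, feasible (costA M) qA ->
         strong_revenueA qA pB <= strong_revenueA pA pB /\
         weak_revenueA qA pB <= weak_revenueA pA pB) &
      (forall qB, feasible (costB M) qB ->
         strong_revenueB pA qB <= strong_revenueB pA pB /\
         weak_revenueB pA qB <= weak_revenueB pA pB)].
Proof.
have th'_gt0 : 0 < 1 - theta M by rewrite subr_gt0.
split=> -[fA fB bestA bestB]; split=> // q [fs fw].
- case: (fA) => fsA fwA; split.
  + have /bestA : feasible (costA M) (Prices (strong q) (weak pA)) by [].
    by rewrite !profitAE lerD2r ler_pM2l.
  + have /bestA : feasible (costA M) (Prices (strong pA) (weak q)) by [].
    by rewrite !profitAE lerD2l ler_pM2l.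
- case: (fB) => fsB fwB; split.
  + have /bestB : feasible (costB M) (Prices (strong q) (weak pB)) by [].
    by rewrite !profitBE lerD2r ler_pM2l.
  + have /bestB : feasible (costB M) (Prices (strong pB) (weak q)) by [].
    by rewrite !profitBE lerD2l ler_pM2l.
- have [? ?] := bestA q (conj fs fw).
  by rewrite !profitAE lerD // ler_pM2l.
- have [? ?] := bestB q (conj fs fw).
  by rewrite !profitBE lerD // ler_pM2l.
Qed.

End ProfitDecomposition.

Theorem proposition5 (R : realType) (cA cB la lb sa sb th : R)
    (cB_ge0 : 0 <= cB) (cB_le_cA : cB <= cA)
    (la_gt0 : 0 < la) (lb_gt0 : 0 < lb)
    (sa_ge0 : 0 <= sa) (sb_ge0 : 0 <= sb)
    (th_gt0 : 0 < th) (th_lt1 : th < 1)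
    (regionIII : Num.max (lb - sb) (sa + 2 * la) <= cA - cB) :
  let M := {| costA := cA; costB := cB; l_alpha := la; l_beta := lb;
              s_alpha := sa; s_beta := sb; theta := th |} in
  let pA := {| strong := cA; weak := cA |} in
  let pB := {| strong := cA + sb; weak := cA - sa - la |} in
  pure_nash M (@uniform_cdf R) pA pB /\
  (forall qA qB : prices R,
     pure_nash M (@uniform_cdf R) qA qB -> qA = pA /\ qB = pB).
Proof.
move=> M pA pB; move: regionIII; rewrite ge_max => /andP[regb rega].
have nashP := @pure_nashP _ M la_gt0 lb_gt0 th_gt0 th_lt1.
split.
  apply/nashP; split.
  - by split=> /=.
  - by split=> /=; lra.
  - move=> q [/= fs fw]; split.
    (* Against [pB], the price at which [A] loses its last customer is [cA] on both sub-markets, so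
       every feasible price earns zero. *)
    + rewrite /strong_revenueA /= !margin_revenue_eq0 //; lra.
    + rewrite /weak_revenueA /= !margin_revenue_eq0 //; lra.
  (* The prices in [pB] are limit prices, and Region III says exactly that their margins are at
     least [lb] and [la]. In [2 * la], one [la] comes from the limit price and one from the
     margin. *)
  - move=> q _; split; apply: margin_revenue_le_limit => //=; lra.
move=> [sA wA] [sB wB] /nashP[[/= fsA fwA] [/= fsB fwB] bestA bestB].
(* Feasibility, [sA >= cA] and [wA >= cA], carries the two margin bounds over to arbitrary prices of
   [A]. *)
have wBE : wB = sA - sa - la.
  apply: (best_response_eq_limit la_gt0 (c := cB)) => [|q fq]; first lra.
  by have [] := bestB (Prices sB q) (conj fsB fq).
have sBE : sB = wA + sb.
  apply: (best_response_eq_limit lb_gt0 (c := cB)) => [|q fq]; first lra.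
  by have [] := bestB (Prices q wB) (conj fq fwB).
(* The replies of [B] place each price of [A] exactly where its demand reaches zero, which is a best
   response only at cost. *)
have uA : wB + sa + la = sA by rewrite wBE; ring.
have uB : sB - sb - lb + lb = wA by rewrite sBE; ring.
have sAE : sA = cA.
  rewrite -uA; apply: best_response_unsold => [//||q fq]; rewrite uA //.
  by have [] := bestA (Prices q wA) (conj fq fwA).
have wAE : wA = cA.
  rewrite -uB; apply: best_response_unsold => [//||q fq]; rewrite uB //.
  by have [] := bestA (Prices sA q) (conj fsA fq).
by rewrite /pA /pB wBE sBE sAE wAE.
Qed.
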